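(* Let $m\in\mathbb{N}$, $s>0$ and $x=1+1/s$. Then the Crank-Nicolson matrix $A_m=(a_{ij})_{1\le i,j\le m}$ can be written in terms of the polynomials $U_m$, $P_m$ and $C_n$, $n=1,\dots,m-1$, as follows. Put $r=r(i,j)=\min\{i,\,j,\,m+1-i,\,m+1-j\}$. Then $$a_{ij}=\frac{1}{U_m(x)}\sum_{k=0}^{r-1}C_{m-|i-j|-2k}(x)\qquad (i\ne j),$$ $$a_{ii}=\frac{1}{U_m(x)}\Big(P_m(x)+\sum_{k=1}^{r-1}C_{m-2k}(x)\Big).$$ In particular, the first row is $\frac{1}{U_m}(P_m,C_{m-1},\dots,C_2,C_1)$; if $m$ is odd the central diagonal entry is $\frac{1}{U_m}\big(P_m+\sum_{n=1}^{(m-1)/2}C_{2n-1}\big)$; and if $m$ is even the two central diagonal entries both equal $\frac{1}{U_m}\big(P_m+\sum_{n=1}^{(m-2)/2}C_{2n}\big)$ and the entries in positions $(\frac m2,\frac m2+1)$ and $(\frac m2+1,\frac m2)$ both equal $\frac1{U_m}\sum_{n=1}^{m/2}C_{2n-1}$ (all polynomials evaluated at $x=1+1/s$).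
   Context: $\mathbb{N}=\{1,2,3,\dots\}$. For $m\in\mathbb{N}$ and $s>0$, the Crank-Nicolson iteration matrix is the $m\times m$ matrix $A_m=M_m(s)^{-1}N_m(s)$, where $M_m(s)$ is the $m\times m$ tridiagonal matrix with diagonal entries $1+s$ and sub- and super-diagonal entries $-s/2$, and $N_m(s)$ is the $m\times m$ tridiagonal matrix with diagonal entries $1-s$ and sub- and super-diagonal entries $s/2$. The polynomials are defined, for $n\ge2$, by the common recurrence $Q_n(x)=2xQ_{n-1}(x)-Q_{n-2}(x)$ with different initial values: $U_0=1,\ U_1=2x$ (Chebyshev polynomials of the second kind); $P_0=-1,\ P_1=2x-4$; $C_0=0,\ C_1=4(x-1)$. One has $C_n=P_n+U_n$. Empty sums are zero. *)

(* Defs.v *)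
From mathcomp Require Import all_boot all_order all_algebra.

Set Implicit Arguments.
Unset Strict Implicit.
Unset Printing Implicit Defensive.

Import Order.TTheory GRing.Theory Num.Theory.
Local Open Scope ring_scope.

Section CrankNicolson.
Variable R : realFieldType.

Definition tridiag_mx (m : nat) (d e : R) : 'M[R]_m :=
  \matrix_(i < m, j < m)
    if i == j :> nat then d
    else if (i.+1 == j :> nat) || (j.+1 == i :> nat) then e
    else 0.

Definition CN_M (m : nat) (s : R) : 'M[R]_m := tridiag_mx m (1 + s) (- (s / 2)).

Definition CN_N (m : nat) (s : R) : 'M[R]_m := tridiag_mx m (1 - s) (s / 2).

Definition CN_mx (m : nat) (s : R) : 'M[R]_m := invmx (CN_M m s) *m CN_N m s.

Fixpoint cheb_rec (q0 q1 : {poly R}) (n : nat) : {poly R} :=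
  match n with
  | 0 => q0
  | n1.+1 => match n1 with
             | 0 => q1
             | n2.+1 => 2%:P * 'X * cheb_rec q0 q1 n1 - cheb_rec q0 q1 n2
             end
  end.

Definition chebU : nat -> {poly R} := cheb_rec 1 (2%:P * 'X).

Definition chebP : nat -> {poly R} := cheb_rec (-1) (2%:P * 'X - 4%:P).

Definition chebC : nat -> {poly R} := cheb_rec 0 (4%:P * ('X - 1)).

End CrankNicolson.

(* The arguments i and j are 1-based matrix indices, 1 <= i, j <= m, whereas
   the elements of 'I_m are 0-based: the entry of A in row p and column q
   (p, q : 'I_m) has depth  border_depth m p.+1 q.+1. *)
Definition border_depth (m i j : nat) : nat :=
  minn (minn i j) (minn (m + 1 - i) (m + 1 - j)).

(* Main.v *)
Require Import Defs.
From mathcomp Require Import all_boot all_order all_algebra.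
From mathcomp Require Import zify ring lra.

Set Implicit Arguments.
Unset Strict Implicit.
Unset Printing Implicit Defensive.

Import Order.TTheory GRing.Theory Num.Theory.
Local Open Scope ring_scope.

(** Put V n = U_(n-1), so that V 0 = 0 and V 1 = 1.  As 1 + s = s * x, the
    matrix M is s / 2 times the tridiagonal matrix T with entries 2 * x and -1,
    and M + N = 2, so A = 2 M^-1 - 1 = 4 (x - 1) T^-1 - 1.  The inverse of T is
    a discrete Green kernel: with indices starting from 1, its entry at (i, j)
    is V (min i j) * V (m + 1 - max i j) / V (m + 1) ([tridiag_mul_green]).
    Indeed each column satisfies the recurrence of V on either side of its
    diagonal entry and vanishes at the fictitious rows 0 and m + 1.

    Both the value of T times the kernel on the diagonal and the expansion of
    the products V a * V b as sums come from one identity,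
      V (a+1) * V (b+1) = V (a+b+1) + V a * V b   ([chebV_add]):
    iterating it lowers a and b until one of them is 0, and the number of
    terms so produced is min a b, which for the kernel is the depth r.  Since
    C n = 4 (x - 1) V n and P = C - U, this is the stated formula; the
    diagonal 1 that is subtracted turns the leading C m into P m.  The special
    rows and entries are reindexings of the general sums. *)

(** * Sequences satisfying the Chebyshev recurrence *)

Section ChebyshevSequences.
Variables (R : realFieldType) (x : R).
Implicit Types (f g : nat -> R) (q : {poly R}).

Definition cheb_seq f := forall n, f n.+2 = 2 * x * f n.+1 - f n.

Lemma cheb_seq_unique f g :
  cheb_seq f -> cheb_seq g -> f 0%N = g 0%N -> f 1%N = g 1%N -> f =1 g.
Proof.
move=> fS gS fg0 fg1 n.
suff [] : f n = g n /\ f n.+1 = g n.+1 by [].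
by elim: n => [|n [IH IH1]] //; split; rewrite // fS gS IH IH1.
Qed.

Lemma horner_cheb_rec q0 q1 : cheb_seq (fun n => (cheb_rec q0 q1 n).[x]).
Proof. by move=> n; rewrite /= !hornerE. Qed.

(** The index shift V n = U_(n-1): starting from 0 makes V vanish at the
    boundary rows of the matrices below. *)
Definition chebV n : R := (cheb_rec 0 1 n).[x].

Lemma chebV0 : chebV 0 = 0. Proof. exact: horner0. Qed.

Lemma chebV1 : chebV 1 = 1. Proof. exact: hornerC. Qed.

Lemma chebVSS n : chebV n.+2 = 2 * x * chebV n.+1 - chebV n.
Proof. exact: horner_cheb_rec. Qed.

Lemma horner_chebU n : (chebU R n).[x] = chebV n.+1.
Proof.
move: n; apply: cheb_seq_unique => [||| /=].
- exact: horner_cheb_rec.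
- by move=> n; exact: chebVSS.
- by rewrite chebV1 /= hornerE.
- by rewrite chebVSS chebV0 chebV1 !hornerE; ring.
Qed.

Lemma horner_chebC n : (chebC R n).[x] = 4 * (x - 1) * chebV n.
Proof.
move: n; apply: cheb_seq_unique => [|n||/=].
- exact: horner_cheb_rec.
- by rewrite chebVSS; ring.
- by rewrite chebV0 /= hornerE; ring.
- by rewrite chebV1 !hornerE; ring.
Qed.

Lemma horner_chebP n : (chebP R n).[x] = (chebC R n).[x] - (chebU R n).[x].
Proof.
move: n; apply: cheb_seq_unique => [|n||/=].
- exact: horner_cheb_rec.
- by rewrite !horner_cheb_rec; ring.
- by rewrite /= !hornerE; ring.
- by rewrite !hornerE; ring.
Qed.

(** For fixed b, both sides of the identity satisfy the recurrence in a. *)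
Lemma chebV_add a b :
  chebV a.+1 * chebV b.+1 = chebV (a + b).+1 + chebV a * chebV b.
Proof.
apply/eqP; rewrite -subr_eq; apply/eqP; move: a.
apply: cheb_seq_unique => [n|n||].
- by rewrite !chebVSS; ring.
- by rewrite !addSn chebVSS.
- by rewrite chebV0 chebV1; ring.
- by rewrite add1n !chebVSS chebV0 chebV1; ring.
Qed.

(** [chebV_add] iterated until a or b is 0. *)
Lemma chebV_mul a b :
  chebV a * chebV b = \sum_(0 <= k < minn a b) chebV (a + b - 1 - 2 * k).
Proof.
elim: a b => [|a IH] b; first by rewrite min0n big_geq // chebV0 mul0r.
case: b => [|b]; first by rewrite minn0 big_geq // chebV0 mulr0.
rewrite minnSS big_nat_recl // chebV_add IH; congr (chebV _ + _); first lia.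
by apply: eq_bigr => k _; congr chebV; lia.
Qed.

(** V (n+2) - V (n+1) is 2 (x - 1) V (n+1) plus the previous difference. *)
Lemma chebV_ge0_ltS n : 1 <= x -> 0 <= chebV n < chebV n.+1.
Proof.
move=> x_ge1; elim: n => [|n /andP[V_ge0 ltV]].
  by rewrite chebV0 chebV1 lexx ltr01.
by rewrite chebVSS; apply/andP; split; nra.
Qed.

Lemma chebV_gt0 n : 1 <= x -> 0 < chebV n.+1.
Proof. by case/(chebV_ge0_ltS n)/andP; exact: le_lt_trans. Qed.

(** * Inversion of the tridiagonal matrix *)

(** The values F 0 and F m.+1 at the two fictitious rows vanish, so that the
    first and last rows of the matrix follow the same formula as the others. *)
Lemma tridiag_mx_row m (d e : R) (F : nat -> R) (i : 'I_m) :
    F 0%N = 0 -> F m.+1 = 0 ->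
  \sum_(k < m) tridiag_mx m d e i k * F k.+1 =
  d * F i.+1 + e * (F i + F i.+2).
Proof.
move=> F0 Fm.
have pick p : (p < m)%N -> \sum_(k < m) (p == k :> nat)%:R * F k.+1 = F p.+1.
  move=> lt_pm; rewrite (bigD1 (Ordinal lt_pm)) //= eqxx mul1r big1 ?addr0 // => k.
  by rewrite -val_eqE /= eq_sym => /negPf->; rewrite mul0r.
have pick_next : \sum_(k < m) (i.+1 == k :> nat)%:R * F k.+1 = F i.+2.
  have [/pick //|] := ltnP i.+1 m; rewrite leq_eqVlt ltnNge ltn_ord orbF => /eqP m_eq.
  rewrite -m_eq Fm big1 // => k _.
  by rewrite (gtn_eqF (ltn_ord k)) mul0r.
have pick_prev : \sum_(k < m) (k.+1 == i :> nat)%:R * F k.+1 = F i.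
  case: {pick_next} i => -[|p] lt_im /=; first by rewrite F0 big1 // => k _; rewrite mul0r.
  rewrite -(pick p) ?(ltnW lt_im) //.
  by apply: eq_bigr => k _; rewrite eqSS eq_sym.
rewrite -[F i.+1]pick // -pick_next -pick_prev mulrDr !mulr_sumr -!big_split /=.
apply: eq_bigr => k _; rewrite mxE.
by do 3![case: eqVneq => ? /=]; try lia; ring.
Qed.

(** In terms of the indices i, j = 1, ..., m, the solution vanishing at 0 times
    the one vanishing at m + 1. *)
Definition green_entry m i j := chebV (minn i j) * chebV (m.+1 - maxn i j).

Definition green_mx m : 'M[R]_m := \matrix_(i, j) green_entry m i.+1 j.+1.

Lemma tridiag_mul_green m :
  tridiag_mx m (2 * x) (-1) *m green_mx m = (chebV m.+1)%:M.
Proof.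
apply/matrixP=> i j; rewrite !mxE.
under eq_bigr do rewrite [green_mx m _ _]mxE.
rewrite ((@tridiag_mx_row _ _ _ (fun k => green_entry m k j.+1))); first last.
- by rewrite /green_entry (maxn_idPl _) ?subnn ?chebV0 ?mulr0 // ltnS ltnW.
- by rewrite /green_entry min0n chebV0 mul0r.
have lt_im := ltn_ord i; have lt_jm := ltn_ord j; rewrite /green_entry.
have [lt_ij|lt_ji|eq_ij] := ltngtP i j.
- have [-> -> ->] : [/\ minn i.+1 j.+1 = i.+1, minn i j.+1 = i & minn i.+2 j.+1 = i.+2].
    by split; lia.
  have [-> -> ->] : [/\ maxn i.+1 j.+1 = j.+1, maxn i j.+1 = j.+1 & maxn i.+2 j.+1 = j.+1].
    by split; lia.
  rewrite chebVSS -val_eqE /= (ltn_eqF lt_ij) mulr0n; ring.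
- have [-> -> ->] : [/\ minn i.+1 j.+1 = j.+1, minn i j.+1 = j.+1 & minn i.+2 j.+1 = j.+1].
    by split; lia.
  have [-> -> ->] : [/\ m.+1 - maxn i.+1 j.+1 = (m - i.+1).+1,
     m.+1 - maxn i j.+1 = (m - i.+1).+2 & m.+1 - maxn i.+2 j.+1 = m - i.+1]%N.
    by split; lia.
  rewrite chebVSS -val_eqE /= (gtn_eqF lt_ji) mulr0n; ring.
- have -> : i = j by exact: val_inj.
  rewrite eqxx mulr1n minnn maxnn.
  have [-> ->] : minn j j.+1 = j /\ minn j.+2 j.+1 = j.+1 by lia.
  have [-> ->] : maxn j j.+1 = j.+1 /\ maxn j.+2 j.+1 = j.+2 by lia.
  set p := (m - j.+1)%N.
  have [-> ->] : (m.+1 - j.+1 = p.+1)%N /\ (m.+1 - j.+2 = p)%N by lia.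
  (* By the recurrence at j, the left-hand side is the difference below, and
     [chebV_add] evaluates it. *)
  have -> : chebV m.+1 = chebV j.+2 * chebV p.+1 - chebV j.+1 * chebV p.
    by rewrite chebV_add addrK; congr chebV; lia.
  by rewrite chebVSS; ring.
Qed.

(** * Entries of the Crank-Nicolson matrix *)

Section Entries.
Variables (m : nat) (s : R).
Hypotheses (s_gt0 : 0 < s) (xE : x = 1 + 1 / s).

Lemma CN_x_ge1 : 1 <= x.
Proof. by rewrite xE lerDl divr_ge0 ?ler01 ?ltW. Qed.

Lemma CN_M_mul_green :
  CN_M m s *m ((2 * (x - 1) / chebV m.+1) *: green_mx m) = 1%:M.
Proof.
have s_neq0 : s != 0 by rewrite gt_eqF.
have Vm_neq0 : chebV m.+1 != 0 by rewrite gt_eqF // chebV_gt0 // CN_x_ge1.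
have -> : CN_M m s = (s / 2) *: tridiag_mx m (2 * x) (-1).
  apply/matrixP=> i j; rewrite !mxE.
  by do 3?[case: eqVneq => _ /=]; rewrite ?xE; field.
rewrite -scalemxAl -scalemxAr tridiag_mul_green !scale_scalar_mx; congr _%:M.
by rewrite xE; field; rewrite Vm_neq0 s_neq0.
Qed.

Lemma CN_M_unit : CN_M m s \in unitmx.
Proof. by case/mulmx1_unit: CN_M_mul_green. Qed.

(** From M + N = 2, that is, A = 2 M^-1 - 1. *)
Lemma CN_mxE (i j : 'I_m) :
  CN_mx m s i j =
    4 * (x - 1) * green_entry m i.+1 j.+1 / chebV m.+1 - (i == j)%:R.
Proof.
have -> : CN_mx m s = 2 *: invmx (CN_M m s) - 1%:M.
  have -> : CN_mx m s = invmx (CN_M m s) *m (2%:M - CN_M m s).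
    congr mulmx; apply/matrixP=> k l; rewrite !mxE -val_eqE /=.
    by do 3?[case: eqVneq => _ /=]; rewrite ?mulr1n ?mulr0n; field.
  by rewrite mulmxBr mulVmx ?CN_M_unit // mul_mx_scalar.
have -> : invmx (CN_M m s) = (2 * (x - 1) / chebV m.+1) *: green_mx m.
  by rewrite -[RHS](mulKmx CN_M_unit) CN_M_mul_green mulmx1.
by rewrite !mxE; ring.
Qed.

(** The two factors of the kernel have indices a = min (i, j) and
    b = m + 1 - max (i, j), counting i and j from 1: the depth is min a b, and
    the first index a + b - 1 in the expansion of V a * V b is m - |i - j|. *)
Lemma CN_mx_sumE (i j : 'I_m) :
  CN_mx m s i j =
    1 / chebV m.+1 * (\sum_(0 <= k < border_depth m i.+1 j.+1)
                        (chebC R (m - `|i - j| - 2 * k)).[x])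
    - (i == j)%:R.
Proof.
have lt_im := ltn_ord i; have lt_jm := ltn_ord j.
rewrite CN_mxE /green_entry chebV_mul; congr (_ - _).
have -> : border_depth m i.+1 j.+1 = minn (minn i.+1 j.+1) (m.+1 - maxn i.+1 j.+1).
  by rewrite /border_depth; lia.
have -> : (minn i.+1 j.+1 + (m.+1 - maxn i.+1 j.+1) - 1 = m - `|i - j|)%N by lia.
under [in RHS]eq_bigr do rewrite horner_chebC.
by rewrite -mulr_sumr; ring.
Qed.

End Entries.

End ChebyshevSequences.

Theorem proposition1 (R : realFieldType) (m : nat) (s x : R)
    (m_gt0 : (0 < m)%N) (s_gt0 : 0 < s) (xE : x = 1 + 1 / s) :
  let A := CN_mx m s in
  let U n := (chebU R n).[x] in
  let P n := (chebP R n).[x] in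
  let C n := (chebC R n).[x] in
  let r (i j : 'I_m) := border_depth m i.+1 j.+1 in
  (* the inverse matrix and the quotients below are meaningful *)
  CN_M m s \in unitmx /\ U m != 0 /\
  (* off-diagonal entries *)
  (forall i j : 'I_m, i != j ->
     A i j = 1 / U m * \sum_(0 <= k < r i j) C (m - `|i - j| - 2 * k)%N) /\
  (* diagonal entries *)
  (forall i : 'I_m,
     A i i = 1 / U m * (P m + \sum_(1 <= k < r i i) C (m - 2 * k)%N)) /\
  (* first row *)
  (row (Ordinal m_gt0) A =
     (1 / U m) *: \row_(j < m) (if j == 0%N :> nat then P m else C (m - j)%N)) /\
  (* m odd: central diagonal entry *)
  (odd m -> forall i : 'I_m, i.+1 = ((m + 1) %/ 2)%N ->
     A i i = 1 / U m *
       (P m + \sum_(1 <= n < ((m - 1) %/ 2).+1) C (2 * n - 1)%N)) /\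
  (* m even: central two-by-two block *)
  (~~ odd m -> forall i j : 'I_m,
     i.+1 = (m %/ 2)%N -> j.+1 = (m %/ 2 + 1)%N ->
     [/\ A i i = 1 / U m *
           (P m + \sum_(1 <= n < ((m - 2) %/ 2).+1) C (2 * n)%N),
         A j j = 1 / U m *
           (P m + \sum_(1 <= n < ((m - 2) %/ 2).+1) C (2 * n)%N),
         A i j = 1 / U m * \sum_(1 <= n < (m %/ 2).+1) C (2 * n - 1)%N &
         A j i = 1 / U m * \sum_(1 <= n < (m %/ 2).+1) C (2 * n - 1)%N]).
Proof.
move=> A U P C r.
have Um_neq0 : U m != 0.
  by rewrite /U horner_chebU gt_eqF // chebV_gt0 // (CN_x_ge1 s_gt0 xE).
have AE i j : A i j =
    1 / U m * (\sum_(0 <= k < r i j) C (m - `|i - j| - 2 * k)%N) - (i == j)%:R.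
  by rewrite /A (CN_mx_sumE s_gt0 xE) /U horner_chebU.
have offdiag i j : i != j ->
    A i j = 1 / U m * \sum_(0 <= k < r i j) C (m - `|i - j| - 2 * k)%N.
  by move=> /negPf ij; rewrite AE ij subr0.
have diag i : A i i = 1 / U m * (P m + \sum_(1 <= k < r i i) C (m - 2 * k)%N).
  have r_gt0 : (0 < r i i)%N by have := ltn_ord i; rewrite /r /border_depth; lia.
  rewrite AE eqxx big_ltn // distnn !subn0.
  have -> : P m = C m - U m by rewrite /P horner_chebP.
  by rewrite mulr1n; field.
split; first exact: CN_M_unit s_gt0 xE.
do 3!(split; first by []); split; [|split].
- apply/rowP=> j; rewrite mxE [RHS]mxE [X in _ * X]mxE.
  have r1 : r (Ordinal m_gt0) j = 1%N.
    by have := ltn_ord j; rewrite /r /border_depth /=; lia.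
  case: eqVneq => j0.
    have jE : j = Ordinal m_gt0 by exact: val_inj.
    by rewrite jE diag -{2}jE r1 big_geq // addr0.
  rewrite offdiag ?r1 ?big_nat1 1?eq_sym //.
  by congr (_ * C _); rewrite /=; lia.
- move=> m_odd i iE; rewrite diag; congr (_ * (_ + _)).
  have [h mE] : exists h, m = h.*2.+1 by exists m./2; lia.
  have {}iE : i = h :> nat by lia.
  have -> : r i i = h.+1 by rewrite /r /border_depth iE mE; lia.
  have -> : ((m - 1) %/ 2 = h)%N by lia.
  by rewrite big_nat_rev; apply: eq_big_nat => k ?; congr C; lia.
- move=> m_even i j iE jE.
  have [h mE] : exists h, m = h.+1.*2 by exists m./2.-1; lia.
  have -> : ((m - 2) %/ 2 = h)%N by lia.
  have hE : (m %/ 2 = h.+1)%N by lia.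
  have {}iE : i = h :> nat by lia.
  have {}jE : j = h.+1 :> nat by lia.
  rewrite hE.
  have diagE (k : 'I_m) : r k k = h.+1 ->
      A k k = 1 / U m * (P m + \sum_(1 <= n < h.+1) C (2 * n)%N).
    move=> rE; rewrite diag rE big_nat_rev; congr (_ * (_ + _)).
    by apply: eq_big_nat => n ?; congr C; lia.
  have offE (k l : 'I_m) : `|k - l|%N = 1%N -> r k l = h.+1 ->
      A k l = 1 / U m * \sum_(1 <= n < h.+2) C (2 * n - 1)%N.
    move=> kl rE; rewrite offdiag; last by apply/eqP=> E; rewrite E distnn in kl.
    rewrite rE kl big_add1 big_nat_rev; congr (_ * _).
    by apply: eq_big_nat => n ?; congr C; lia.
  by split; [apply: diagE|apply: diagE|apply: offE|apply: offE];
    rewrite /r /border_depth ?iE ?jE ?mE; lia.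
Qed.
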